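(* Let $G$ be a group and $A$ a set. The monoid $\mathrm{CA}(G;A)$ is vN-regular if and only if $|G| = 1$ or $|A| = 1$.
   Context: Functions are applied on the right, and composition is read left to right: $\tau\sigma$ means first $\tau$, then $\sigma$. For a group $G$ and a set $A$, $A^G$ is the set of all functions $x: G\to A$; $G$ acts on $A^G$ by $(h)(x\cdot g) := (hg^{-1})x$ for $g,h\in G$, $x\in A^G$. A cellular automaton over $A^G$ is a map $\tau : A^G \to A^G$ for which there exist a finite subset $S \subseteq G$ (a memory set) and a function $\mu : A^S \to A$ (a local function) such that $(g)(x)\tau = ((x\cdot g^{-1})|_S)\mu$ for all $x\in A^G$, $g\in G$. $\mathrm{CA}(G;A)$ is the monoid of all cellular automata over $A^G$ under composition. An element $a$ of a monoid $M$ is vN-regular (von Neumann regular) if there exists $b\in M$ with $aba=a$; the monoid $M$ is vN-regular if all of its elements are vN-regular.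
   Formalization: The set A is assumed nonempty: for A empty and |G| > 1 the set A^G is empty, so CA(G;A) is the trivial monoid and is vN-regular although |G| ≠ 1 and |A| ≠ 1. *)

(* Defs.v *)
From HB Require Import structures.
From mathcomp Require Import all_boot finmap.
From mathcomp Require Import boolp classical_sets functions cardinality.
Set Implicit Arguments.
Unset Strict Implicit.
Unset Printing Implicit Defensive.

Local Open Scope group_scope.
Local Open Scope fset_scope.

Definition vN_regular_elt (M : monoidType) (a : M) : Prop :=
  exists b : M, a * b * a = a.

Definition vN_regular (M : monoidType) : Prop :=
  forall a : M, vN_regular_elt a.

Section CellularAutomata.
Variables (G : groupType) (A : Type).

(* Functions on the right, (h)x, are written x h; shift x g is x . g. *)
Definition shift (x : G -> A) (g : G) : G -> A := fun h => x (h * g^-1).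

Definition restr (x : G -> A) (S : {fset G}) : S -> A := fun s => x (val s).
Arguments restr : clear implicits.

Definition is_local_function (tau : (G -> A) -> (G -> A)) (S : {fset G})
    (mu : (S -> A) -> A) : Prop :=
  forall (x : G -> A) (g : G), tau x g = mu (restr (shift x g^-1) S).

Definition is_CA (tau : (G -> A) -> (G -> A)) : Prop :=
  exists (S : {fset G}) (mu : (S -> A) -> A), is_local_function tau mu.

Lemma is_CA_id : is_CA id.
Proof.
exists [fset 1], (fun y => y [` fset11 1]) => x g.
by rewrite /restr /shift /= invgK mul1g.
Qed.

Lemma is_CA_comp tau sigma : is_CA tau -> is_CA sigma -> is_CA (sigma \o tau).
Proof.
move=> [S [mu Hmu]] [T [nu Hnu]].
pose ST := [fset s * t | s in S, t in T].
have inST (t : T) (s : S) : val s * val t \in ST.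
  exact: in_imfset2 (valP s) (valP t).
exists ST, (fun y => nu (fun t => mu (fun s => y [` inST t s]))) => x g.
rewrite /= Hnu; congr nu; apply/funext => t.
rewrite /restr {1}/shift Hmu; congr mu; apply/funext => s.
by rewrite /restr /shift /= !invgK mulgA.
Qed.

Record CA : Type := MkCA {
  CA_fun :> (G -> A) -> (G -> A);
  CA_prop : is_CA CA_fun }.

Lemma CA_inj (tau sigma : CA) : CA_fun tau = CA_fun sigma -> tau = sigma.
Proof.
case: tau sigma => [f Hf] [h Hh] /= E; subst h.
by congr MkCA; apply: Prop_irrelevance.
Qed.

HB.instance Definition _ := gen_eqMixin CA.
HB.instance Definition _ := gen_choiceMixin CA.

Definition CA_one : CA := MkCA is_CA_id.

(* Maps act on the right: tau * sigma is first tau, then sigma. *)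
Definition CA_mul (tau sigma : CA) : CA :=
  MkCA (is_CA_comp (CA_prop tau) (CA_prop sigma)).

Lemma CA_mulA : associative CA_mul.
Proof. by move=> a b c; apply: CA_inj. Qed.

Lemma CA_mul1 : left_id CA_one CA_mul.
Proof. by move=> a; apply: CA_inj. Qed.

Lemma CA_mul1r : right_id CA_one CA_mul.
Proof. by move=> a; apply: CA_inj. Qed.

HB.instance Definition _ := isMonoid.Build CA CA_mulA CA_mul1 CA_mul1r.

End CellularAutomata.

(* Main.v *)
(** An element b with a b a = a sends every point of the image of a
    to a preimage, and preserves constant configurations because it commutes
    with shifts.  So a cellular automaton is not regular as soon as some
    constant configuration has a preimage but no constant preimage.  If g <> 1
    and a0 <> a1, the automaton returning a0 where the configuration is constant
    on {g^-1 h, h, g h} and a1 elsewhere has this property: the indicator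
    function of a maximal independent set of the graph h -- g h is mapped to the
    constant a1. *)
Require Import Defs.
From mathcomp Require Import all_boot finmap.
From mathcomp Require Import boolp classical_sets functions cardinality.
Set Implicit Arguments.
Unset Strict Implicit.
Unset Printing Implicit Defensive.
Local Open Scope classical_set_scope.
Local Open Scope card_scope.

Lemma vN_regular_CAP (G : groupType) (A : Type) (tau : CA G A) :
  vN_regular_elt tau <->
  exists sigma : CA G A, forall x, tau (sigma (tau x)) = tau x.
Proof.
split=> -[sigma tauK]; exists sigma.
  by move=> x; rewrite -[in RHS]tauK.
by apply: CA_inj; apply/funext => x; apply: tauK.
Qed.

Lemma CA_cst (G : groupType) (A : Type) (sigma : CA G A) (a : A) :
  exists b : A, sigma (fun=> a) = (fun=> b).
Proof.
have [T [nu sigmaE]] := CA_prop sigma.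
by exists (nu (fun=> a)); apply/funext => h; rewrite sigmaE.
Qed.

Lemma vN_regular_cst_preimage (G : groupType) (A : Type) (tau : CA G A)
    (x : G -> A) (a : A) :
  vN_regular_elt tau -> tau x = (fun=> a) ->
  exists b : A, tau (fun=> b) = (fun=> a).
Proof.
move=> /vN_regular_CAP[sigma tauK] tauxE.
by have [b sigmaE] := CA_cst sigma a; exists b; rewrite -sigmaE -tauxE tauK.
Qed.

(** Zorn's lemma applies because two points of the union of a chain lie in a common member. If [h]
    is outside a maximal [I], adding [h] breaks independence; as [g != 1] excludes loops, a
    neighbour of [h] is in [I]. *)
Lemma maximal_independent_set (G : groupType) (g : G) : g != 1%g ->
  exists I : set G, forall h,
    (I h -> ~ I (g * h)%g) /\ (~ I h -> I (g * h)%g \/ I (g^-1 * h)%g).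
Proof.
move=> gN1; pose indep (I : set G) := forall h, I h -> ~ I (g * h)%g.
have [F Find totF h [X FX Xh] [Y FY Ygh]|I [indI maxI]] := @Zorn_bigcup G indep.
  have [XY|YX] := totF X Y FX FY.
  - exact: Find FY h (XY _ Xh) Ygh.
  - exact: Find FX h Xh (YX _ Ygh).
have ghNh h : (g * h)%g <> h.
  by move/(canRL (mulgK h)); rewrite mulgV; apply/eqP.
exists I => h; split=> [|INh]; first exact: indI.
apply: contrapT => /not_orP[INgh INg'h].
apply: (maxI (I `|` [set h])).
  by split=> [k Ik|/(_ h (or_intror erefl))//]; left.
move=> k [Ik|->] [].
- exact: indI.
- by move=> gkh; apply: INg'h; rewrite -gkh mulKg.
- exact: INgh.
- exact: ghNh.
Qed.

Section NonRegular.
Variables (G : groupType) (A : Type) (g : G) (a0 a1 : A).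

Definition nonconst_fun (x : G -> A) (h : G) : A :=
  if `[< x (g^-1 * h)%g = x h /\ x (g * h)%g = x h >] then a0 else a1.

Lemma is_CA_nonconst : is_CA nonconst_fun.
Proof.
(* The local rule at [h] reads [x (s * h)] for [s] in [S], hence the left translates. *)
pose S : {fset G} := [fset g^-1; 1; g]%fset%g.
have S1 : 1%g \in S by rewrite !inE eqxx orbT.
have Sg : g \in S by rewrite !inE eqxx orbT.
have Sg' : g^-1%g \in S by rewrite !inE eqxx.
exists S, (fun y => if `[< y [` Sg']%fset = y [` S1]%fset /\
  y [` Sg]%fset = y [` S1]%fset >] then a0 else a1) => x h.
by rewrite /nonconst_fun /restr /shift /= !invgK mul1g.
Qed.

Lemma nonconst_not_regular : g != 1%g -> a0 <> a1 ->
  ~ vN_regular_elt (MkCA is_CA_nonconst).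
Proof.
move=> gN1 a01 reg; have [I indI] := maximal_independent_set gN1.
pose x h := if `[< I h >] then a1 else a0.
have xE : nonconst_fun x = (fun=> a1).
  apply/funext => h; rewrite /nonconst_fun; case: asboolP => // -[].
  rewrite /x; have [IN Imax] := indI h.
  case: (asboolP (I h)) => [/IN INgh _|/Imax[]].
  - by case: asboolP.
  - by move=> Igh _; case: asboolP => // _ /esym.
  - by move=> Ig'h; case: asboolP => // _ /esym.
have [b] := vN_regular_cst_preimage reg xE.
by move=> /(congr1 (@^~ 1%g)) /=; rewrite /nonconst_fun; case: asboolP => // -[].
Qed.

End NonRegular.

(** Over the trivial group every self-map of [G -> A] is a cellular automaton, so any choice of
    preimages under [tau] will do. *)
Lemma vN_regular_trivial_group (G : groupType) (A : Type) :
  (forall g : G, g = 1%g) -> vN_regular (CA G A).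
Proof.
move=> G1 tau; apply/vN_regular_CAP.
have /choice[sigma sigmaP] (y : G -> A) :
    exists x, (exists z, tau z = y) -> tau x = y.
  have [[x xE]|Ny] := pselect (exists z, tau z = y); first by exists x.
  (* Outside the image of [tau] the value is arbitrary. *)
  by exists y.
suff CAsigma : is_CA sigma.
  by exists (MkCA CAsigma) => x; apply: sigmaP; exists x.
(* A configuration is determined by its value at [1]. *)
exists [fset 1%g]%fset, (fun y => sigma (fun=> y [` fset11 1%g]%fset) 1%g).
move=> x h; rewrite (G1 h); congr (sigma _ _); apply/funext => k.
by rewrite /restr /shift (G1 k) /= invgK mulg1.
Qed.

Lemma vN_regular_subsingleton (G : groupType) (A : Type) :
  (forall a b : A, a = b) -> vN_regular (CA G A).
Proof.
move=> A1 tau; exists tau; apply: CA_inj.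
by apply/funext => x; apply/funext => h; apply: A1.
Qed.

(** The point [t] excludes the empty type, which satisfies the right-hand side with cardinal 0. *)
Lemma card_setT_eq1 (T : Type) (t : T) :
  [set: T] #= `I_1 <-> forall u v : T, u = v.
Proof.
split=> [/card_set_bijP[f [f0 finj _]] u v|T1].
  apply: finj; rewrite ?in_setT//.
  by move: (f0 u I) (f0 v I) => /=; case: (f u) (f v) => [|//] [].
suff -> : [set: T] = [set t] by apply: card_set1.
by apply/seteqP; split=> // u _; apply: T1.
Qed.

Theorem theorem2 (G : groupType) (A : Type) (A_nonempty : inhabited A) :
  vN_regular (CA G A) <-> ([set: G] #= `I_1 \/ [set: A] #= `I_1).
Proof.
have [a] := A_nonempty.
rewrite (card_setT_eq1 (1%g : G)) (card_setT_eq1 a); split=> [reg|[G1|A1]].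
- have [G1|/existsNP[g /eqP gN1]] := pselect (forall g : G, g = 1%g).
    by left=> g h; rewrite (G1 g) (G1 h).
  right=> a0 a1; apply: contrapT => a01.
  exact: nonconst_not_regular gN1 a01 (reg _).
- by apply: vN_regular_trivial_group => g; apply: G1.
- exact: vN_regular_subsingleton.
Qed.
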